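(* Let $A\in\mathbb{R}^{m\times m}$ be a discretized operator of an elliptic problem on a domain $\Omega$, and consider the RAS iterative process with iteration matrix $T_{RAS}=I_m-M_{RAS,\delta}^{-1}A$ defined on $p$ domains. Suppose that the error transfer operator $P\in\mathbb{R}^{n\times n}$ on the interface $\Gamma$ is diagonalisable, $P=\mathbb{U}\hat{\hat P}\mathbb{U}^{-1}$ with $\hat{\hat P}=\mathrm{diag}(\lambda_1,\dots,\lambda_n)$. Then the RAS error on the interface, written in the eigenvector space as $\hat{\hat e}^k_{|\Gamma}=\mathbb{U}^{-1}R_\Gamma(u^k-u)$, satisfies $\hat{\hat e}^{k+1}_{|\Gamma}=\hat{\hat P}\,\hat{\hat e}^k_{|\Gamma}$, so that each mode converges linearly and independently of the others: $\hat{\hat e}^{k+1}_{|\Gamma,i}=\lambda_i\,\hat{\hat e}^k_{|\Gamma,i}$ for $1\le i\le n$. Let $1\le q<n$ and let the first $q$ modes be the strong modes, i.e. $|\lambda_1|\ge\dots\ge|\lambda_q|>|\lambda_{q+1}|\ge\dots\ge|\lambda_n|$. Let $Q_\lambda=\mathrm{diag}(q_1,\dots,q_n)\in\mathbb{R}^{n\times n}$ with $q_l=1$ if $1\le l\le q$ and $q_l=0$ if $l>q$, let $\bar Q_\lambda=I_n-Q_\lambda$, and let $\tilde P=Q_\lambda\hat{\hat P}$ be the coarse approximation of $\hat{\hat P}$. Define the preconditioner $$M_{ARAS(q),\delta}^{-1}=\left(I_m+R_\Gamma^T\,\mathbb{U}\left((I_n-\tilde P)^{-1}-I_n\right)\mathbb{U}^{-1}R_\Gamma\right)\sum_{i=1}^p\tilde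 R_{i,\delta}^TA_{i,\delta}^{-1}R_{i,\delta}$$ and $T_{ARAS(q)}=I_m-M_{ARAS(q),\delta}^{-1}A$. Then the spectral radius of $T_{ARAS(q)}$ is $$\rho(T_{ARAS(q)})=\rho(\bar Q_\lambda\hat{\hat P})=|\lambda_{q+1}|<\min\{|\lambda_i|:1\le i\le q\}.$$
   Context: Setting. $A=(a_{ij})\in\mathbb{R}^{m\times m}$ is nonsingular, and $Au=f$ is the linear system to solve, with solution $u$. Let $W=\{1,\dots,m\}$, with a non-overlapping partition $W=\bigcup_{i=1}^p W_{i,0}$. For an integer $\delta\ge 0$, the overlapping sets $W_{i,\delta}\supset W_{i,\delta-1}$ are obtained by adding to $W_{i,\delta-1}$ all its immediate neighbours in the adjacency graph of $A$ (edges $(i,j)$ with $a_{ij}\ne 0$). $R_{i,\delta}\in\mathbb{R}^{m_{i,\delta}\times m}$ is the Boolean restriction matrix to $W_{i,\delta}$ ($m_{i,\delta}=|W_{i,\delta}|$). $\tilde R_{i,\delta}\in\mathbb{R}^{m_{i,\delta}\times m}$ is the same matrix with the rows corresponding to indices outside $W_{i,0}$ replaced by zero. $A_{i,\delta}=R_{i,\delta}AR_{i,\delta}^T$ is assumed nonsingular. RAS (Restricted Additive Schwarz): $M_{RAS,\delta}^{-1}=\sum_{i=1}^p\tilde R_{i,\delta}^TA_{i,\delta}^{-1}R_{i,\delta}$ (notation; $M_{RAS,\delta}^{-1}$ denotes this matrix), with iteration $u^k=u^{k-1}+M_{RAS,\delta}^{-1}(f-Au^{k-1})$. Interface: $\Gamma_i$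 is the artificial interface of $W_{i,\delta}$, i.e. the set of indices $j\notin W_{i,\delta}$ with $a_{kj}\neq0$ for some $k\in W_{i,\delta}$; $\Gamma=\bigcup_{i=1}^p\Gamma_i$, $n=|\Gamma|$, and $R_\Gamma\in\mathbb{R}^{n\times m}$ is the Boolean restriction to $\Gamma$, so $R_\Gamma R_\Gamma^T=I_n$. Error transfer operator: the constant matrix $P\in\mathbb{R}^{n\times n}$ such that, for every initial guess, the RAS iterates satisfy $R_\Gamma(u^{k+1}-u)=P\,R_\Gamma(u^k-u)$. $P$ and $I_n-P$ are assumed nonsingular. The eigenvalues $\lambda_i$ and the eigenvector matrix $\mathbb{U}$ may be complex. $\rho$ denotes the spectral radius. *)

(* Defs.v *)
From mathcomp Require Import classical_sets reals.
From mathcomp Require Import all_boot all_order all_algebra.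
From mathcomp Require Import complex.

Set Implicit Arguments.
Unset Strict Implicit.
Unset Printing Implicit Defensive.

Import Order.TTheory GRing.Theory Num.Theory.
Local Open Scope ring_scope.
Local Open Scope complex_scope.

Definition cmod (R : realType) (z : R[i]) : R := ComplexField.Normc.normc z.

(* [eigenvalue] refers to row (left) eigenvectors; a square matrix has the same
   eigenvalues on either side. For n > 0 the set is finite and nonempty, so that
   this supremum is a maximum. *)
Definition spectral_radius (R : realType) (n : nat) (B : 'M[R[i]]_n) : R :=
  sup [set r : R | exists2 a, eigenvalue B a & r = cmod a]%classic.

Definition to_complex (R : realType) (m n : nat) (B : 'M[R]_(m, n)) :
    'M[R[i]]_(m, n) := map_mx (real_complex R) B.

(* Row k is the unit vector of the k-th index of S in increasing order. *)
Definition restr (F : nzRingType) (m : nat) (S : {set 'I_m}) : 'M[F]_(#|S|, m) :=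
  rowsub (fun k : 'I_#|S| => enum_val k) 1%:M.

Definition restr_tilde (F : nzRingType) (m : nat) (S S0 : {set 'I_m}) :
    'M[F]_(#|S|, m) :=
  \matrix_(k, j) if enum_val k \in S0 then restr F S k j else 0.

Section RAS.

Variables (R : realType) (m p : nat).
Variables (A : 'M[R]_m) (W0 : 'I_p -> {set 'I_m}) (delta : nat).

(* Edges are oriented: the neighbours of row index k are the j with a_kj != 0,
   the same direction as in the interface. *)
Definition neighbours (S : {set 'I_m}) : {set 'I_m} :=
  [set j | [exists k in S, A k j != 0]].

Definition overlap (i : 'I_p) : {set 'I_m} :=
  iter delta (fun S => S :|: neighbours S) (W0 i).

Definition interface_of (i : 'I_p) : {set 'I_m} :=
  neighbours (overlap i) :\: overlap i.

Definition interface : {set 'I_m} := \bigcup_(i < p) interface_of i.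

Definition local_mx (i : 'I_p) : 'M[R]_#|overlap i| :=
  restr R (overlap i) *m A *m (restr R (overlap i))^T.

Definition MRAS_inv : 'M[R]_m :=
  \sum_(i < p) (restr_tilde R (overlap i) (W0 i))^T
               *m invmx (local_mx i) *m restr R (overlap i).

Definition ras_iterate (f u0 : 'cV[R]_m) (k : nat) : 'cV[R]_m :=
  iter k (fun v => v + MRAS_inv *m (f - A *m v)) u0.

Definition error_transfer (f u : 'cV[R]_m) (P : 'M[R]_#|interface|) : Prop :=
  forall (u0 : 'cV[R]_m) (k : nat),
    restr R interface *m (ras_iterate f u0 k.+1 - u) =
    P *m (restr R interface *m (ras_iterate f u0 k - u)).

(* The interface error of the k-th iterate in the basis of eigenvectors. *)
Definition hat_error (U : 'M[R[i]]_#|interface|) (f u u0 : 'cV[R]_m) (k : nat) :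
    'cV[R[i]]_#|interface| :=
  invmx U *m to_complex (restr R interface *m (ras_iterate f u0 k - u)).

Definition Qlam (n q : nat) : 'M[R[i]]_n := diag_mx (\row_l (l < q)%N%:R).

Definition Qbar (n q : nat) : 'M[R[i]]_n := 1%:M - Qlam n q.

Definition MARAS_inv (U : 'M[R[i]]_#|interface|) (lam : 'rV[R[i]]_#|interface|)
    (q : nat) : 'M[R[i]]_m :=
  let RG := restr R[i] interface in
  let Pt := Qlam #|interface| q *m diag_mx lam in
  (1%:M + RG^T *m U *m (invmx (1%:M - Pt) - 1%:M) *m invmx U *m RG)
  *m to_complex MRAS_inv.

Definition TARAS (U : 'M[R[i]]_#|interface|) (lam : 'rV[R[i]]_#|interface|)
    (q : nat) : 'M[R[i]]_m :=
  1%:M - MARAS_inv U lam q *m to_complex A.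

End RAS.

(* Indices start at 0: the modes 1, ..., q of the usual numbering are the
   ordinals below q, and lambda_(q+1) is the entry of index q. *)
Definition strong_modes (R : realType) (n : nat) (lam : 'rV[R[i]]_n) (q : nat) :
    Prop :=
  (forall l l' : 'I_n, (l <= l')%N -> cmod (lam 0 l') <= cmod (lam 0 l)) /\
  (forall l l' : 'I_n, l.+1 = q -> l' = q :> nat ->
     cmod (lam 0 l') < cmod (lam 0 l)).

(* min { |lambda_l| : l < q } for 0 < q < n; the fold starts at lambda_1, which
   belongs to the set. *)
Definition min_strong (R : realType) (n : nat) (lam : 'rV[R[i]]_n) (q : nat)
    (q_gt0 : (0 < q)%N) (q_lt : (q < n)%N) : R :=
  \big[Num.min/cmod (lam 0 (Ordinal (ltn_trans q_gt0 q_lt)))]_(l < n | (l < q)%N)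
    cmod (lam 0 l).

(* Main.v *)
Require Import Defs.
From mathcomp Require Import reals.
From mathcomp Require Import all_boot all_order all_algebra.
From mathcomp Require Import complex.

Import Order.TTheory GRing.Theory Num.Theory.
Local Open Scope ring_scope.
Local Open Scope complex_scope.

(** Put [T = 1 - M A], where [M] is the RAS preconditioner, and let [G] be the
    restriction to the interface.  Since [u^(k+1) - u = T (u^k - u)] and the
    initial guess is arbitrary, the definition of [P] says [G T = P G], whence
    the first claim after conjugation by [U].

    For the spectral radius, the key fact is that [T] annihilates every vector
    that vanishes on the interface ([RAS_error_supported_on_interface]): for
    such an [e], the row [k] of [A e], for [k] in a subdomain, only involves the
    entries of [e] inside that subdomain, so each local solve returns [e]
    exactly and the restricted extensions reassemble it, i.e. [M A e = e].
    The same then holds for [T_ARAS].  Moreover, with [R' = U^-1 G], one has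
    [R' T_ARAS = (1 - (1 - Q Lambda)^-1 (1 - Lambda)) R' = Qbar Lambda R'],
    because [1 - Lambda = (1 - Q Lambda)(1 - Qbar Lambda)].  So [T_ARAS] factors
    through the interface, where it acts as [Qbar Lambda]; both matrices have
    the same nonzero eigenvalues ([eigenvalue_lift], [eigenvalue_descend]), and
    the eigenvalue 0 does not affect the maximum modulus [|lambda_(q+1)|]. *)

(** * Intertwined matrices *)

(** Left eigenvectors of [B] pull back along [G]. *)
Lemma eigenvalue_lift {F : fieldType} {m n : nat} {S : 'M[F]_m} {B : 'M[F]_n}
    {G : 'M[F]_(n, m)} {L : 'M[F]_(m, n)} :
  G *m L = 1%:M -> G *m S = B *m G ->
  forall a, eigenvalue B a -> eigenvalue S a.
Proof.
move=> GL GS a /eigenvalueP[v vB v0]; apply/eigenvalueP; exists (v *m G).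
  by rewrite -mulmxA GS mulmxA vB scalemxAl.
apply: contra v0 => /eqP vG0.
by rewrite -(mulmx1 v) -GL mulmxA vG0 mul0mx.
Qed.

(** Conversely, when [S] factors through [G], left eigenvectors [v] of [S]
    push forward to [v S L]; this is nonzero only for nonzero eigenvalues. *)
Lemma eigenvalue_descend {F : fieldType} {m n : nat} {S : 'M[F]_m}
    {B : 'M[F]_n} {G : 'M[F]_(n, m)} {L : 'M[F]_(m, n)} :
  G *m L = 1%:M -> G *m S = B *m G -> S *m L *m G = S ->
  forall a, a != 0 -> eigenvalue S a -> eigenvalue B a.
Proof.
move=> GL GS SLG a a0 /eigenvalueP[v vS v0].
apply/eigenvalueP; exists (v *m S *m L).
  have -> : B = G *m S *m L by rewrite GS -mulmxA GL mulmx1.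
  have -> : v *m S *m L *m (G *m S *m L) = v *m (S *m L *m G) *m S *m L.
    by rewrite !mulmxA.
  by rewrite SLG {1}vS -!scalemxAl.
apply: contra v0 => /eqP w0; rewrite -(inj_eq (scalerI a0)) scaler0 -vS.
by rewrite -SLG !mulmxA w0 mul0mx.
Qed.

Lemma eigenvalue_diag_mx (F : fieldType) (n : nat) (d : 'rV[F]_n) (a : F) :
  eigenvalue (diag_mx d) a <-> exists i, a = d 0 i.
Proof.
split=> [/eigenvalueP[v vd /rV0Pn[i vi0]]|[i ->]].
  exists i; apply: (mulfI vi0).
  by move/rowP/(_ i): vd; rewrite mul_mx_diag !mxE => ->; rewrite mulrC.
apply/eigenvalueP; exists (delta_mx 0 i).
  apply/rowP=> j; rewrite mul_mx_diag !mxE eqxx /=.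
  by have [->|_] := eqVneq j i; rewrite ?mulr1 ?mul1r ?mulr0 ?mul0r.
by apply/rV0Pn; exists i; rewrite mxE !eqxx oner_neq0.
Qed.

(** * Restriction matrices *)

(** The diagonal projector onto the coordinates in [S]. *)
Definition indic_mx (F : nzRingType) {m : nat} (S : {set 'I_m}) : 'M[F]_m :=
  diag_mx (\row_j (j \in S)%:R).

Lemma restr_mul_tr (F : nzRingType) (m : nat) (S : {set 'I_m}) :
  restr F S *m (restr F S)^T = 1%:M.
Proof.
apply/matrixP=> i j; rewrite !mxE (bigD1 (enum_val i)) //= !mxE eqxx mul1r.
rewrite big1 ?addr0 => [|k ki]; last by rewrite !mxE eq_sym (negPf ki) mul0r.
by rewrite (inj_eq enum_val_inj) eq_sym.
Qed.

Lemma tr_restr_mul (F : nzRingType) (m : nat) (S : {set 'I_m}) :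
  (restr F S)^T *m restr F S = indic_mx F S.
Proof.
apply/matrixP=> a b; rewrite !mxE.
under eq_bigr do rewrite !mxE.
rewrite -(big_enum_val (A := mem S) (fun k => (k == a)%:R * (k == b)%:R)) /=.
have [aS|aS] := boolP (a \in S).
  rewrite (bigD1 a) //= eqxx mul1r big1 ?addr0 // => k /andP[_ /negPf->].
  by rewrite mul0r.
rewrite big1 ?mul0rn // => k kS; rewrite (_ : (k == a) = false) ?mul0r //.
by apply/negP=> /eqP ka; rewrite -ka kS in aS.
Qed.

Lemma restr_tildeE (F : nzRingType) (m : nat) (S S0 : {set 'I_m}) :
  restr_tilde F S S0 = restr F S *m indic_mx F S0.
Proof.
rewrite /indic_mx mul_mx_diag; apply/matrixP=> k j; rewrite !mxE.
have [<-|_] := eqVneq (enum_val k) j; last by rewrite mul0r if_same.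
by rewrite mul1r; case: ifP.
Qed.

Lemma tr_restr_tilde_mul (F : comNzRingType) (m : nat) (S S0 : {set 'I_m}) :
  S0 \subset S -> (restr_tilde F S S0)^T *m restr F S = indic_mx F S0.
Proof.
move=> sS; rewrite restr_tildeE trmx_mul -mulmxA tr_restr_mul tr_diag_mx.
rewrite /indic_mx mulmx_diag; congr diag_mx; apply/rowP=> j; rewrite !mxE.
have [/(subsetP sS)->|_] := boolP (j \in S0); first by rewrite mulr1.
by rewrite mul0r.
Qed.

Lemma sum_indic_partition (F : nzRingType) (m p : nat)
    (W0 : 'I_p -> {set 'I_m}) :
  injective W0 -> finset.partition [set W0 i | i : 'I_p] [set: 'I_m] ->
  \sum_(i < p) indic_mx F (W0 i) = 1%:M.
Proof.
move=> W0_inj /and3P[/eqP covW /trivIsetP trivW _].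
apply/matrixP=> a b; rewrite summxE !mxE.
under eq_bigr do rewrite !mxE.
have /bigcupP[_ /imsetP[i _ ->] ai] : a \in finset.cover [set W0 i | i : 'I_p].
  by rewrite covW inE.
rewrite (bigD1 i) //= ai big1 ?addr0 // => j ji.
rewrite (_ : (a \in W0 j) = false) ?mul0rn //.
have dis : [disjoint W0 j & W0 i].
  apply: trivW; [exact: imset_f | exact: imset_f |].
  by rewrite (inj_eq W0_inj).
by apply/negP=> aj; rewrite (disjointFr dis aj) in ai.
Qed.

(** * Restricted additive Schwarz *)

Lemma sub_overlap {R : realType} {m p : nat} (A : 'M[R]_m)
    (W0 : 'I_p -> {set 'I_m}) (delta : nat) (i : 'I_p) :
  W0 i \subset overlap A W0 delta i.
Proof.
rewrite /overlap; elim: delta => //= d IH.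
exact: subset_trans IH (subsetUl _ _).
Qed.

(** On vectors vanishing on the interface, the rows of [A] indexed by a
    subdomain only involve the entries inside that subdomain. *)
Lemma restr_mul_local {R : realType} {m p : nat} (A : 'M[R]_m)
    (W0 : 'I_p -> {set 'I_m}) (delta : nat) (i : 'I_p) :
  let Ri := restr R (overlap A W0 delta i) in
  let D := 1%:M - indic_mx R (interface A W0 delta) in
  Ri *m A *m D = local_mx A W0 delta i *m Ri *m D.
Proof.
move=> Ri D; apply/eqP; rewrite -subr_eq0 -mulmxBl; apply/eqP.
rewrite /local_mx -!mulmxA tr_restr_mul -/Ri.
have -> : Ri *m A = Ri *m (A *m 1%:M) by rewrite mulmx1.
rewrite -!mulmxBr -!mulmxA.
have -> : D = diag_mx (\row_j (j \notin interface A W0 delta)%:R).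
  apply/matrixP=> a b; rewrite !mxE -mulrnBl; congr (_ *+ _).
  by case: (a \in _); rewrite ?subrr ?subr0.
have -> : 1%:M - indic_mx R (overlap A W0 delta i)
    = diag_mx (\row_j (j \notin overlap A W0 delta i)%:R).
  apply/matrixP=> a b; rewrite !mxE -mulrnBl; congr (_ *+ _).
  by case: (a \in _); rewrite ?subrr ?subr0.
rewrite mulmx_diag mul_mx_diag /Ri /restr mul_rowsub_mx mul1mx.
apply/matrixP=> k j; rewrite !mxE.
have [jW|jW] /= := boolP (j \in overlap _ _ _ _); first by rewrite mul0r mulr0.
have [jG|jG] /= := boolP (j \in interface _ _ _); first by rewrite !mulr0.
have [->|Akj] := eqVneq (A (enum_val k) j) 0; first by rewrite mul0r.
case/bigcupP: jG; exists i => //; rewrite inE jW inE.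
by apply/exists_inP; exists (enum_val k); first exact: enum_valP.
Qed.

(** [G^T G] is the projector onto the interface coordinates: after one RAS step,
    the error depends only on the values of the previous error there. *)
Lemma RAS_error_supported_on_interface {R : realType} {m p : nat}
    {A : 'M[R]_m} {W0 : 'I_p -> {set 'I_m}} {delta : nat} :
  injective W0 -> finset.partition [set W0 i | i : 'I_p] [set: 'I_m] ->
  (forall i : 'I_p, local_mx A W0 delta i \in unitmx) ->
  let T := 1%:M - MRAS_inv A W0 delta *m A in
  let G := restr R (interface A W0 delta) in
  T *m G^T *m G = T.
Proof.
move=> W0_inj W0_part Ai_unit T G; rewrite -mulmxA tr_restr_mul.
set D := 1%:M - indic_mx R (interface A W0 delta).
suff TD0 : T *m D = 0.
  by apply/esym/eqP; rewrite -subr_eq0 -{1}(mulmx1 T) -mulmxBr TD0.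
rewrite /T mulmxBl mul1mx /MRAS_inv !mulmx_suml.
rewrite -[X in X - _]mul1mx -(sum_indic_partition _ _ _ _ W0_inj W0_part).
rewrite mulmx_suml -sumrB big1 // => i _.
rewrite -!mulmxA (mulmxA (restr _ _)) restr_mul_local -mulmxA.
rewrite mulKmx ?Ai_unit // mulmxA tr_restr_tilde_mul ?subrr //.
exact: sub_overlap.
Qed.

Lemma ras_error_step {R : realType} {m p : nat} (A : 'M[R]_m)
    (W0 : 'I_p -> {set 'I_m}) (delta : nat) (u v : 'cV[R]_m) :
  v + MRAS_inv A W0 delta *m (A *m u - A *m v) - u =
  (1%:M - MRAS_inv A W0 delta *m A) *m (v - u).
Proof.
by rewrite -mulmxBr mulmxBl mul1mx -(opprB v u) !mulmxN mulmxA addrAC.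
Qed.

Lemma error_transfer_intertwines {R : realType} {m p : nat} {A : 'M[R]_m}
    {W0 : 'I_p -> {set 'I_m}} {delta : nat} {f u : 'cV[R]_m}
    {P : 'M[R]_#|interface A W0 delta|} :
  A *m u = f -> error_transfer f u P ->
  let G := restr R (interface A W0 delta) in
  G *m (1%:M - MRAS_inv A W0 delta *m A) = P *m G.
Proof.
move=> <- PT G; apply/matrixP=> i j.
(* The first step from the initial error [e_j] gives the [j]-th column. *)
have := PT (delta_mx j 0 + u) 0%N.
rewrite /ras_iterate /= ras_error_step addrK !mulmxA -!colE.
by move/colP/(_ i); rewrite !mxE.
Qed.

(** * The accelerated preconditioner *)

(** [G] and [L] stand for the interface restriction and its right inverse in
    the eigenvector basis, [Lam] for the transfer operator in that basis.  When
    [Lam = Pt + Bt] with [Pt Bt = 0], inverting [1 - Pt] exactly eliminates the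
    [Pt] part of the interface error and leaves [Bt]. *)
Lemma accelerated_intertwines {F : fieldType} {m n : nat} {T : 'M[F]_m}
    {Lam Pt Bt : 'M[F]_n} {G : 'M[F]_(n, m)} {L : 'M[F]_(m, n)} :
  G *m L = 1%:M -> G *m T = Lam *m G -> Lam = Pt + Bt -> Pt *m Bt = 0 ->
  1%:M - Lam \in unitmx ->
  G *m (1%:M - (1%:M + L *m (invmx (1%:M - Pt) - 1%:M) *m G) *m (1%:M - T))
  = Bt *m G.
Proof.
move=> GL GT LamE PB0 unitL.
have fac : 1%:M - Lam = (1%:M - Pt) *m (1%:M - Bt).
  by rewrite mulmxBl mul1mx mulmxBr mulmx1 PB0 subr0 LamE opprD addrAC addrA.
have unitPt : 1%:M - Pt \in unitmx.
  by move: unitL; rewrite fac unitmx_mul => /andP[].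
set J := invmx _.
have -> : G *m (1%:M - (1%:M + L *m (J - 1%:M) *m G) *m (1%:M - T))
    = G - G *m (1%:M + L *m (J - 1%:M) *m G) *m (1%:M - T).
  by rewrite [LHS]mulmxBr mulmx1 mulmxA.
have -> : G *m (1%:M + L *m (J - 1%:M) *m G) = J *m G.
  by rewrite mulmxDr mulmx1 !mulmxA GL mul1mx mulmxBl mul1mx addrC subrK.
have -> : J *m G *m (1%:M - T) = J *m (1%:M - Lam) *m G.
  by rewrite -!mulmxA mulmxBr mulmx1 GT [in RHS]mulmxBl mul1mx.
by rewrite fac mulKmx // mulmxBl mul1mx opprB addrC subrK.
Qed.

(** The acceleration corrects interface values only, so the iteration matrix
    still depends on the interface values alone. *)
Lemma accelerated_supported {F : fieldType} {m n : nat} {T : 'M[F]_m}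
    {G : 'M[F]_(n, m)} {L : 'M[F]_(m, n)} (K : 'M[F]_n) :
  G *m L = 1%:M -> T *m L *m G = T ->
  let S := 1%:M - (1%:M + L *m K *m G) *m (1%:M - T) in
  S *m L *m G = S.
Proof.
move=> GL TLG S; apply/eqP; rewrite -subr_eq0; apply/eqP.
set Z := L *m G - 1%:M.
have GZ : G *m Z = 0 by rewrite mulmxBr mulmxA GL mul1mx mulmx1 subrr.
have TZ : (1%:M - T) *m Z = Z.
  by rewrite mulmxBl mul1mx {2}/Z mulmxBr mulmxA TLG mulmx1 subrr subr0.
have -> : S *m L *m G - S = S *m Z by rewrite mulmxBr mulmx1 mulmxA.
have -> : S *m Z = Z - (1%:M + L *m K *m G) *m ((1%:M - T) *m Z).
  by rewrite mulmxA mulmxBl mul1mx.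
by rewrite TZ mulmxDl mul1mx -(mulmxA _ G) GZ mulmx0 addr0 subrr.
Qed.

(** * Strong and weak modes *)

Lemma Qbar_diag (R : realType) (n q : nat) (lam : 'rV[R[i]]_n) :
  Qbar R n q *m diag_mx lam = diag_mx (\row_l if (l < q)%N then 0 else lam 0 l).
Proof.
rewrite /Qbar mulmxBl mul1mx /Qlam mulmx_diag -raddfB /=.
congr diag_mx; apply/rowP=> l; rewrite !mxE.
by case: ifP; rewrite ?mul1r ?mul0r ?subrr ?subr0.
Qed.

Lemma Qlam_mul_Qbar (R : realType) (n q : nat) (lam : 'rV[R[i]]_n) :
  Qlam R n q *m diag_mx lam *m (Qbar R n q *m diag_mx lam) = 0.
Proof.
rewrite Qbar_diag /Qlam !mulmx_diag -[RHS](raddf0 (@diag_mx _ n)) /=.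
congr diag_mx; apply/rowP=> l; rewrite !mxE.
by case: ifP; rewrite ?mulr0 ?mul0r.
Qed.

Lemma cmod0 (R : realType) : cmod (0 : R[i]) = 0.
Proof. exact: ComplexField.Normc.normc0. Qed.

Lemma cmod_ge0 (R : realType) (z : R[i]) : 0 <= cmod z.
Proof. by case: z => a b; exact: sqrtr_ge0. Qed.

Lemma spectral_radius_max (R : realType) (n : nat) (B : 'M[R[i]]_n) (b : R[i]) :
  eigenvalue B b -> (forall a, eigenvalue B a -> cmod a <= cmod b) ->
  spectral_radius B = cmod b.
Proof.
move=> Bb Bmax; apply/eqP; rewrite eq_le /spectral_radius.
apply/andP; split; first by apply: ge_sup => [|_ [a Ba ->]];
  [exists (cmod b), b | exact: Bmax].
apply: ub_le_sup; last by exists b.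
by exists (cmod b) => _ [a Ba ->]; exact: Bmax.
Qed.

Lemma min_strong_gt (R : realType) (n : nat) (lam : 'rV[R[i]]_n) (q : nat)
    (q_gt0 : (0 < q)%N) (q_lt : (q < n)%N) :
  strong_modes lam q -> cmod (lam 0 (Ordinal q_lt)) < min_strong lam q_gt0 q_lt.
Proof.
move=> [mono gap].
have lt_strong (l : 'I_n) : (l < q)%N ->
    cmod (lam 0 (Ordinal q_lt)) < cmod (lam 0 l).
  (* The gap is stated at the last strong mode [q - 1] only. *)
  move=> lq; have q1n : (q.-1 < n)%N by apply: leq_ltn_trans q_lt; exact: leq_pred.
  apply: (@lt_le_trans _ _ (cmod (lam 0 (Ordinal q1n)))).
    by apply: gap => //=; rewrite prednK.
  by apply: mono; rewrite /= -ltnS prednK.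
by apply: lt_bigmin => [|l]; exact: lt_strong.
Qed.

Theorem theorem4p3 (R : realType) (m p : nat) (A : 'M[R]_m)
    (W0 : 'I_p -> {set 'I_m}) (delta : nat) (f u : 'cV[R]_m)
    (P : 'M[R]_#|interface A W0 delta|)
    (U : 'M[R[i]]_#|interface A W0 delta|)
    (lam : 'rV[R[i]]_#|interface A W0 delta|)
    (A_unit : A \in unitmx)
    (W0_inj : injective W0)
    (W0_part : finset.partition [set W0 i | i : 'I_p] [set: 'I_m])
    (Ai_unit : forall i : 'I_p, local_mx A W0 delta i \in unitmx)
    (u_sol : A *m u = f)
    (P_transfer : error_transfer f u P)
    (P_unit : P \in unitmx)
    (IP_unit : 1%:M - P \in unitmx)
    (U_unit : U \in unitmx)
    (P_diag : to_complex P = U *m diag_mx lam *m invmx U) :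
  (forall (u0 : 'cV[R]_m) (k : nat),
     hat_error U f u u0 k.+1 = diag_mx lam *m hat_error U f u u0 k /\
     forall i : 'I_#|interface A W0 delta|,
       hat_error U f u u0 k.+1 i 0 = lam 0 i * hat_error U f u u0 k i 0) /\
  (forall (q : nat) (q_gt0 : (0 < q)%N) (q_lt : (q < #|interface A W0 delta|)%N),
     strong_modes lam q ->
     [/\ spectral_radius (TARAS U lam q) =
           spectral_radius (Qbar R #|interface A W0 delta| q *m diag_mx lam),
         spectral_radius (Qbar R #|interface A W0 delta| q *m diag_mx lam) =
           cmod (lam 0 (Ordinal q_lt)) &
         cmod (lam 0 (Ordinal q_lt)) < min_strong lam q_gt0 q_lt]).
Proof.
split=> [u0 k|q q_gt0 q_lt strong].
  have step : hat_error U f u u0 k.+1 = diag_mx lam *m hat_error U f u u0 k.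
    rewrite /hat_error P_transfer [to_complex (P *m _)]map_mxM.
    by rewrite -/(to_complex P) P_diag -!mulmxA mulKmx.
  by split=> // i; rewrite step mul_diag_mx mxE.
set n := #|interface A W0 delta| in P U lam P_transfer P_unit IP_unit U_unit
  P_diag q_lt strong *.
set Lam := diag_mx lam in P_diag *.
set T := to_complex (1%:M - MRAS_inv A W0 delta *m A).
set RG := restr R[i] (interface A W0 delta).
set G := invmx U *m RG; set L := RG^T *m U.
have RGE : RG = to_complex (restr R (interface A W0 delta)).
  by rewrite /RG /restr /to_complex map_mxsub map_mx1.
have GL : G *m L = 1%:M.
  by rewrite /G /L -mulmxA (mulmxA RG) restr_mul_tr mul1mx mulVmx.
have LG : L *m G = RG^T *m RG by rewrite /L /G -mulmxA mulKVmx.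
have GT : G *m T = Lam *m G.
  rewrite /G -mulmxA RGE -[_ *m T]map_mxM.
  rewrite (error_transfer_intertwines u_sol P_transfer) map_mxM.
  by rewrite -/(to_complex P) P_diag -!mulmxA mulKmx.
have TLG : T *m L *m G = T.
  rewrite -mulmxA LG mulmxA RGE /to_complex map_trmx -!map_mxM.
  by rewrite (RAS_error_supported_on_interface W0_inj W0_part Ai_unit).
have LamE : Lam = Qlam R n q *m Lam + Qbar R n q *m Lam.
  by rewrite -mulmxDl /Qbar addrC subrK mul1mx.
have IL_unit : 1%:M - Lam \in unitmx.
  have : to_complex (1%:M - P) \in unitmx by rewrite map_unitmx.
  rewrite /to_complex map_mxB map_mx1 -/(to_complex P) P_diag.
  rewrite -{1}(mulmxV U_unit) -{1}(mulmx1 U) -mulmxBl -mulmxBr.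
  by rewrite !unitmx_mul => /andP[/andP[]].
have SE : TARAS U lam q = 1%:M -
    (1%:M + L *m (invmx (1%:M - Qlam R n q *m Lam) - 1%:M) *m G) *m (1%:M - T).
  rewrite /TARAS /MARAS_inv /T /to_complex map_mxB map_mx1 subKr.
  by rewrite map_mxM /L /G !mulmxA.
have GS := accelerated_intertwines GL GT LamE (Qlam_mul_Qbar _ _ _ _) IL_unit.
have SLG := accelerated_supported
  (invmx (1%:M - Qlam R n q *m Lam) - 1%:M) GL TLG.
rewrite -SE in GS SLG.
have specB a : eigenvalue (Qbar R n q *m Lam) a <->
    exists i, a = (\row_l if (l < q)%N then 0 else lam 0 l) 0 i.
  by rewrite /Lam Qbar_diag; exact: eigenvalue_diag_mx.
have eigB : eigenvalue (Qbar R n q *m Lam) (lam 0 (Ordinal q_lt)).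
  by apply/specB; exists (Ordinal q_lt); rewrite mxE /= ltnn.
have maxB a : eigenvalue (Qbar R n q *m Lam) a ->
    cmod a <= cmod (lam 0 (Ordinal q_lt)).
  move=> /specB[i ->]; rewrite mxE.
  by case: ltnP => [_|qi]; [rewrite cmod0 cmod_ge0 | exact: strong.1].
have rhoB := spectral_radius_max _ _ _ _ eigB maxB.
split=> //; last exact: min_strong_gt.
rewrite rhoB; apply: spectral_radius_max; first exact: (eigenvalue_lift GL GS).
move=> a; have [->|a0] := eqVneq a 0; first by rewrite cmod0 cmod_ge0.
by move=> /(eigenvalue_descend GL GS SLG _ a0); exact: maxB.
Qed.
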